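(* Let $\Lambda$ be a left FPE ring. Then the notions of torsion and cotorsion are dual. More precisely, the right adjoint \[D_R:(\mathrm{mod}(\Lambda),\mathrm{Ab})\to\mathrm{fp}(\mathrm{Mod}(\Lambda^{op}),\mathrm{Ab})\] of the Auslander-Gruson-Jensen functor $D_A$ carries the injective torsion functor $\mathfrak{s}$ on right $\Lambda$-modules to the cotorsion functor $\mathfrak{q}$ on left $\Lambda$-modules, i.e., $D_R(\mathfrak{s})\simeq\mathfrak{q}$.
   Context: $\Lambda$ is left FPE if the injective envelope $I$ of the left module ${}_\Lambda\Lambda$ is finitely presented. Let $\iota:\Lambda\to I$ be this injective envelope. For a right $\Lambda$-module $A$, the injective torsion is $\mathfrak{s}(A):=\ker(1\otimes\iota:A\otimes_\Lambda\Lambda\to A\otimes_\Lambda I)\subseteq A$. For a left $\Lambda$-module $C$, the cotorsion module is $\mathfrak{q}(C):=\mathrm{coker}\big(\mathrm{Hom}_\Lambda(I,C)\to\mathrm{Hom}_\Lambda(\Lambda,C)\big)$ (precomposition with $\iota$), i.e. homomorphisms $\Lambda\to C$ modulo those factoring through injective left modules. A covariant functor $F$ from left $\Lambda$-modules to abelian groups is finitely presented if there is an exact sequence $\mathrm{Hom}(Y,\_)\to\mathrm{Hom}(X,\_)\to F\to0$ for some left modules $X,Y$ (not necessarily finitely presented). $\mathrm{fp}(\mathrm{Mod}(\Lambda^{op}),\mathrm{Ab})$ is the abelian category of such functors, and $(\mathrm{mod}(\Lambda),\mathrm{Ab})$ is the category of additive functors from finitely presented right $\Lambda$-modules to abelian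 groups; $\mathfrak{s}$, which commutes with filtered colimits, is identified with its restriction to finitely presented right modules. The functor $D_A:\mathrm{fp}(\mathrm{Mod}(\Lambda^{op}),\mathrm{Ab})\to(\mathrm{mod}(\Lambda),\mathrm{Ab})$ is the contravariant exact functor, unique up to isomorphism, satisfying $D_A(\mathrm{Hom}(M,\_))=\_\otimes_\Lambda M$ (functorially in $M$) for every left module $M$. It is known that the contravariant functor $D_A$ admits a right adjoint $D_R$, a contravariant functor characterized by natural isomorphisms $\mathrm{Hom}(F,D_R(G))\cong\mathrm{Hom}(G,D_A(F))$ for $F\in\mathrm{fp}(\mathrm{Mod}(\Lambda^{op}),\mathrm{Ab})$ and $G\in(\mathrm{mod}(\Lambda),\mathrm{Ab})$. *)

(* Defs.v *)
From HB Require Import structures.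
From mathcomp Require Import all_boot all_order all_algebra.
From mathcomp Require Import generic_quotient ring_quotient.
From mathcomp Require Import boolp.
From mathcomp Require Import freeg.

Set Implicit Arguments.
Unset Strict Implicit.
Unset Printing Implicit Defensive.

Import GRing.Theory.
Local Open Scope ring_scope.
Local Open Scope quotient_scope.

(* Left modules over a ring L are [lmodType L]; right modules over L are
   [lmodType L^c], where [L^c] is the converse ring: for [a : A] and [r : L],
   the right action a.r is [(r : L^c) *: a]. *)

(* The homs are plain types with explicit operations, not [zmodType]s: natural
   transformations between functors defined on all modules live in a larger
   universe than the carriers of [zmodType]. *)
Record preadditive := Preadditive {
  ob :> Type;
  hom : ob -> ob -> Type;
  idm : forall A, hom A A;
  compm : forall A B C, hom B C -> hom A B -> hom A C;
  hzero : forall A B, hom A B;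
  hopp : forall A B, hom A B -> hom A B;
  hadd : forall A B, hom A B -> hom A B -> hom A B;
  compm_idl : forall A B (f : hom A B), compm (idm B) f = f;
  compm_idr : forall A B (f : hom A B), compm f (idm A) = f;
  compmA : forall A B C D (h : hom C D) (g : hom B C) (f : hom A B),
    compm h (compm g f) = compm (compm h g) f;
  haddA : forall A B (f g h : hom A B),
    hadd f (hadd g h) = hadd (hadd f g) h;
  haddC : forall A B (f g : hom A B), hadd f g = hadd g f;
  hadd0l : forall A B (f : hom A B), hadd (hzero A B) f = f;
  haddNl : forall A B (f : hom A B), hadd (hopp f) f = hzero A B;
  compm_addl : forall A B C (g g' : hom B C) (f : hom A B),
    compm (hadd g g') f = hadd (compm g f) (compm g' f);
  compm_addr : forall A B C (g : hom B C) (f f' : hom A B),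
    compm g (hadd f f') = hadd (compm g f) (compm g f')
}.

Arguments hom {p} _ _.
Arguments idm {p} _.
Arguments compm {p A B C} _ _.
Arguments hzero {p} _ _.
Arguments hopp {p A B} _.
Arguments hadd {p A B} _ _.

Declare Scope cat_scope.
Delimit Scope cat_scope with cat.
Local Open Scope cat_scope.
Notation "g ∘ f" := (compm g f) (at level 40, left associativity) : cat_scope.
Notation "f ⊕ g" := (hadd f g) (at level 50, left associativity) : cat_scope.

Section CategoricalNotions.
Variable C : preadditive.

Definition is_iso (A B : C) (f : hom A B) : Prop :=
  exists g : hom B A, g ∘ f = idm A /\ f ∘ g = idm B.

Definition isomorphic (A B : C) : Prop := exists f : hom A B, is_iso f.

Definition is_kernel (A B D : C) (f : hom A B) (g : hom B D) : Prop :=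
  g ∘ f = hzero A D /\
  forall (X : C) (h : hom X B), g ∘ h = hzero X D ->
    exists! k : hom X A, f ∘ k = h.

Definition is_cokernel (A B D : C) (f : hom A B) (g : hom B D) : Prop :=
  g ∘ f = hzero A D /\
  forall (X : C) (h : hom B X), h ∘ f = hzero A X ->
    exists! k : hom D X, k ∘ g = h.

Definition short_exact (A B D : C) (f : hom A B) (g : hom B D) : Prop :=
  is_kernel f g /\ is_cokernel f g.

End CategoricalNotions.

Section FullSubcategory.
Variables (C : preadditive) (P : C -> Prop).

Record full_ob := FullOb { full_val :> C; full_valP : P full_val }.

Definition full_subcat : preadditive :=
  @Preadditive full_ob (fun A B => hom (full_val A) (full_val B))
    (fun A => idm (full_val A)) (fun _ _ _ g f => g ∘ f)
    (fun A B => hzero (full_val A) (full_val B)) (fun _ _ f => hopp f)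
    (fun _ _ f g => f ⊕ g)
    (fun _ _ => @compm_idl C _ _) (fun _ _ => @compm_idr C _ _)
    (fun _ _ _ _ => @compmA C _ _ _ _) (fun _ _ => @haddA C _ _)
    (fun _ _ => @haddC C _ _) (fun _ _ => @hadd0l C _ _)
    (fun _ _ => @haddNl C _ _) (fun _ _ _ => @compm_addl C _ _ _)
    (fun _ _ _ => @compm_addr C _ _ _).

End FullSubcategory.

Record afunctor (C D : preadditive) := AFunctor {
  fob :> C -> D;
  fmap : forall A B : C, hom A B -> hom (fob A) (fob B);
  fmap_id : forall A : C, fmap (idm A) = idm (fob A);
  fmap_comp : forall (A B E : C) (g : hom B E) (f : hom A B),
    fmap (g ∘ f) = fmap g ∘ fmap f;
  fmap_add : forall (A B : C) (f g : hom A B), fmap (f ⊕ g) = fmap f ⊕ fmap g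
}.
Arguments fmap {C D} _ {A B} _.

Section FunctorCategory.
Variables C D : preadditive.

Record nattrans (F G : afunctor C D) := NatTrans {
  nt :> forall A : C, hom (F A) (G A);
  nt_nat : forall (A B : C) (f : hom A B),
    nt B ∘ fmap F f = fmap G f ∘ nt A
}.

Lemma nattrans_ext F G (s t : nattrans F G) : (forall A, s A = t A) -> s = t.
Proof.
case: s t => s sP [t tP] /= st.
have {}st : s = t by apply: functional_extensionality_dep.
by case: _ / st tP => tP; congr NatTrans; apply: Prop_irrelevance.
Qed.

Lemma hadd0r (A B : D) (f : hom A B) : f ⊕ hzero A B = f.
Proof. by rewrite haddC hadd0l. Qed.

Lemma hadd_cancel (A B : D) (f g h : hom A B) : f ⊕ g = f ⊕ h -> g = h.
Proof.
by move=> e; rewrite -(hadd0l g) -(hadd0l h) -(haddNl f) -!haddA e.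
Qed.

Lemma compm_zerol (A B E : D) (f : hom A B) : hzero B E ∘ f = hzero A E.
Proof.
by apply: (@hadd_cancel _ _ (hzero B E ∘ f)); rewrite -compm_addl hadd0l hadd0r.
Qed.

Lemma compm_zeror (A B E : D) (g : hom B E) : g ∘ hzero A B = hzero A E.
Proof.
by apply: (@hadd_cancel _ _ (g ∘ hzero A B)); rewrite -compm_addr hadd0l hadd0r.
Qed.

Lemma compm_oppl (A B E : D) (g : hom B E) (f : hom A B) :
  hopp g ∘ f = hopp (g ∘ f).
Proof.
apply: (@hadd_cancel _ _ (g ∘ f)).
by rewrite -compm_addl (haddC g) (haddC (g ∘ f)) !haddNl compm_zerol.
Qed.

Lemma compm_oppr (A B E : D) (g : hom B E) (f : hom A B) :
  g ∘ hopp f = hopp (g ∘ f).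
Proof.
apply: (@hadd_cancel _ _ (g ∘ f)).
by rewrite -compm_addr (haddC f) (haddC (g ∘ f)) !haddNl compm_zeror.
Qed.

Section Operations.
Variables F G H : afunctor C D.

Lemma nt_id_nat (A B : C) (f : hom A B) :
  idm (F B) ∘ fmap F f = fmap F f ∘ idm (F A).
Proof. by rewrite compm_idl compm_idr. Qed.
Definition nt_id : nattrans F F := NatTrans nt_id_nat.

Lemma nt_comp_nat (t : nattrans G H) (s : nattrans F G) (A B : C)
    (f : hom A B) :
  (t B ∘ s B) ∘ fmap F f = fmap H f ∘ (t A ∘ s A).
Proof. by rewrite -compmA nt_nat compmA nt_nat compmA. Qed.
Definition nt_comp (t : nattrans G H) (s : nattrans F G) : nattrans F H :=
  NatTrans (nt_comp_nat t s).

Lemma nt_zero_nat (A B : C) (f : hom A B) :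
  hzero (F B) (G B) ∘ fmap F f = fmap G f ∘ hzero (F A) (G A).
Proof. by rewrite compm_zerol compm_zeror. Qed.
Definition nt_zero : nattrans F G := NatTrans nt_zero_nat.

Lemma nt_opp_nat (s : nattrans F G) (A B : C) (f : hom A B) :
  hopp (s B) ∘ fmap F f = fmap G f ∘ hopp (s A).
Proof. by rewrite compm_oppl compm_oppr nt_nat. Qed.
Definition nt_opp (s : nattrans F G) : nattrans F G := NatTrans (nt_opp_nat s).

Lemma nt_add_nat (s t : nattrans F G) (A B : C) (f : hom A B) :
  (s B ⊕ t B) ∘ fmap F f = fmap G f ∘ (s A ⊕ t A).
Proof. by rewrite compm_addl compm_addr !nt_nat. Qed.
Definition nt_add (s t : nattrans F G) : nattrans F G :=
  NatTrans (nt_add_nat s t).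

End Operations.

Definition functor_cat : preadditive.
Proof.
refine (@Preadditive (afunctor C D) nattrans nt_id
  (fun F G H => @nt_comp F G H) nt_zero nt_opp nt_add
  _ _ _ _ _ _ _ _ _) => *; apply: nattrans_ext => A /=.
- exact: compm_idl.
- exact: compm_idr.
- exact: compmA.
- exact: haddA.
- exact: haddC.
- exact: hadd0l.
- exact: haddNl.
- exact: compm_addl.
- exact: compm_addr.
Defined.

End FunctorCategory.

Section Restriction.
Variables (C D : preadditive) (P : C -> Prop).

Definition restrict (F : afunctor C D) : afunctor (full_subcat P) D :=
  @AFunctor (full_subcat P) D (fun A => F (full_val A))
    (fun _ _ f => fmap F f) (fun A => fmap_id F (full_val A))
    (fun _ _ _ g f => fmap_comp F g f) (fun _ _ f g => fmap_add F f g).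

Definition restrict_nt (F G : afunctor C D) (s : nattrans F G) :
    nattrans (restrict F) (restrict G) :=
  @NatTrans (full_subcat P) D (restrict F) (restrict G) (fun A => s (full_val A))
    (fun _ _ f => nt_nat s f).

End Restriction.

Record cofunctor (C D : preadditive) := CoFunctor {
  cob :> C -> D;
  cmap : forall A B : C, hom A B -> hom (cob B) (cob A);
  cmap_id : forall A : C, cmap (idm A) = idm (cob A);
  cmap_comp : forall (A B E : C) (g : hom B E) (f : hom A B),
    cmap (g ∘ f) = cmap f ∘ cmap g
}.
Arguments cmap {C D} _ {A B} _.

Definition exact_cofunctor (C D : preadditive) (F : cofunctor C D) : Prop :=
  (forall (A B : C) (f g : hom A B), cmap F (f ⊕ g) = cmap F f ⊕ cmap F g) /\
  (forall (A B E : C) (f : hom A B) (g : hom B E),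
     short_exact f g -> short_exact (cmap F g) (cmap F f)).

(* [S] is right adjoint to the contravariant functor [T]: there are group
   isomorphisms Hom(A, S B) ≅ Hom(B, T A), natural in A and in B. *)
Definition right_adjoint (C D : preadditive)
    (T : cofunctor C D) (S : cofunctor D C) : Prop :=
  exists phi : forall (A : C) (B : D), hom A (S B) -> hom B (T A),
    [/\ forall A B, bijective (@phi A B),
        forall A B (f g : hom A (S B)), phi A B (f ⊕ g) = phi A B f ⊕ phi A B g,
        forall (A A' : C) (B : D) (u : hom A' A) (f : hom A (S B)),
          phi A' B (f ∘ u) = cmap T u ∘ phi A B f
      & forall (A : C) (B B' : D) (v : hom B' B) (f : hom A (S B)),
          phi A B' (cmap S v ∘ f) = phi A B f ∘ v].

Lemma additive_ext (U V : zmodType) (f g : {additive U -> V}) :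
  f =1 g -> f = g.
Proof.
case: f g => f [[fP]] [g [[gP]]] /= fg.
have {}fg : f = g by apply: funext.
by case: _ / fg gP => gP; rewrite (Prop_irrelevance fP gP).
Qed.

Definition Ab : preadditive.
Proof.
refine (@Preadditive zmodType (fun U V => {additive U -> V})
  (fun U => idfun) (fun U V W g f => g \o f)
  (fun U V => \0) (fun U V f => \- f) (fun U V f g => f \+ g)
  _ _ _ _ _ _ _ _ _).
- by move=> U V f; apply: additive_ext.
- by move=> U V f; apply: additive_ext.
- by move=> U V W X h g f; apply: additive_ext.
- by move=> U V f g h; apply: additive_ext => x /=; rewrite addrA.
- by move=> U V f g; apply: additive_ext => x /=; rewrite addrC.
- by move=> U V f; apply: additive_ext => x /=; rewrite add0r.
- by move=> U V f; apply: additive_ext => x /=; rewrite addNr.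
- by move=> U V W g g' f; apply: additive_ext.
- by move=> U V W g f f'; apply: additive_ext => x /=; rewrite raddfD.
Defined.

Section KernelCokernel.
Variables (U V : zmodType) (f : {additive U -> V}).

Definition ker_pred : {pred U} := fun x => f x == 0.

Lemma ker_zmod_closed : zmod_closed ker_pred.
Proof.
split=> [|x y]; rewrite !unfold_in ?raddf0 // => /eqP fx /eqP fy.
by rewrite raddfB fx fy subr0.
Qed.
HB.instance Definition _ := GRing.isZmodClosed.Build U ker_pred ker_zmod_closed.

Record ker := Ker { ker_val : U; ker_valP : ker_val \in ker_pred }.
HB.instance Definition _ := [isSub for ker_val].
HB.instance Definition _ := [Choice of ker by <:].
HB.instance Definition _ := [SubChoice_isSubZmodule of ker by <:].

Definition im_pred : {pred V} := fun y => `[< exists x, f x = y >].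

Lemma im_zmod_closed : zmod_closed im_pred.
Proof.
split; first by apply/asboolP; exists 0; rewrite raddf0.
move=> _ _ /asboolP[x <-] /asboolP[y <-].
by apply/asboolP; exists (x - y); rewrite raddfB.
Qed.
HB.instance Definition _ := GRing.isZmodClosed.Build V im_pred im_zmod_closed.

Definition coker : zmodType := Quotient.quot im_pred.

End KernelCokernel.

Section QuotientMaps.
Variables (V : zmodType) (S : zmodClosed V).

Definition qproj (x : V) : Quotient.quot S := \pi x.

Lemma qproj_additive : zmod_morphism qproj.
Proof. by move=> x y; rewrite /qproj !piE. Qed.
HB.instance Definition _ :=
  GRing.isZmodMorphism.Build V (Quotient.quot S) qproj qproj_additive.

Lemma qproj_surj (z : Quotient.quot S) : exists x, qproj x = z.
Proof. by exists (repr z); rewrite /qproj reprK. Qed.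

Lemma qproj_eq0 x : (qproj x = 0) <-> (x \in S).
Proof.
rewrite /qproj -[X in X \in _]subr0 Quotient.idealrBE.
by rewrite -(raddf0 qproj) /qproj; split=> [->|/eqP].
Qed.

Variables (W : zmodType) (h : {additive V -> W}).

Definition qlift (hS : forall x, x \in S -> h x = 0) (z : Quotient.quot S) : W :=
  h (repr z).

Lemma qliftE hS x : qlift hS (qproj x) = h x.
Proof.
apply/eqP; rewrite -subr_eq0 -raddfB; apply/eqP/hS.
by apply/qproj_eq0; rewrite raddfB /= {1}/qproj reprK subrr.
Qed.

Lemma qlift_additive hS : zmod_morphism (qlift hS).
Proof.
move=> y z; have [x <-] := qproj_surj y; have [x' <-] := qproj_surj z.
by rewrite -raddfB !qliftE raddfB.
Qed.
HB.instance Definition _ hS :=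
  GRing.isZmodMorphism.Build (Quotient.quot S) W (qlift hS) (qlift_additive hS).

End QuotientMaps.

Section FunctorsToAb.
Variables (C : preadditive) (F : afunctor C Ab).

Lemma fmap_idE (A : C) (x : F A) : fmap F (idm A) x = x.
Proof. by rewrite fmap_id. Qed.

Lemma fmap_compE (A B D : C) (g : hom B D) (f : hom A B) (x : F A) :
  fmap F (g ∘ f) x = fmap F g (fmap F f x).
Proof. by rewrite fmap_comp. Qed.

Lemma fmap_addE (A B : C) (f g : hom A B) (x : F A) :
  fmap F (f ⊕ g) x = fmap F f x + fmap F g x.
Proof. by rewrite fmap_add. Qed.

End FunctorsToAb.

Section KernelCokernelFunctors.
Variables (C : preadditive) (F G : afunctor C Ab) (s : nattrans F G).

Lemma nt_natE (A B : C) (f : hom A B) x : s B (fmap F f x) = fmap G f (s A x).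
Proof. exact: (congr1 (fun u : hom (F A) (G B) => u x) (nt_nat s f)). Qed.

Section KerMap.
Variables (A B : C) (f : hom A B).

Lemma ker_mapP (x : ker (s A)) : fmap F f (ker_val x) \in ker_pred (s B).
Proof.
have := ker_valP x; rewrite !unfold_in => /eqP sx.
by rewrite nt_natE sx raddf0.
Qed.

Definition ker_map (x : ker (s A)) : ker (s B) := Ker (ker_mapP x).

Lemma ker_map_additive : zmod_morphism ker_map.
Proof. by move=> x y; apply: val_inj; rewrite /= !raddfB. Qed.
HB.instance Definition _ :=
  GRing.isZmodMorphism.Build (ker (s A)) (ker (s B)) ker_map ker_map_additive.

End KerMap.

Definition ker_functor : afunctor C Ab.
Proof.
refine (@AFunctor C Ab (fun A => ker (s A) : zmodType) (fun _ _ f => ker_map f) _ _ _).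
- by move=> A; apply: additive_ext => x; apply: val_inj; apply: fmap_idE.
- move=> A B D g f; apply: additive_ext => x; apply: val_inj.
  exact: fmap_compE.
- move=> A B f g; apply: additive_ext => x; apply: val_inj.
  exact: fmap_addE.
Defined.

Section CokerMap.
Variables (A B : C) (f : hom A B).

Definition coker_map_rep : {additive G A -> coker (s B)} :=
  @qproj _ (im_pred (s B)) \o fmap G f.

Lemma coker_mapP y : y \in im_pred (s A) -> coker_map_rep y = 0.
Proof.
move=> /asboolP[x <-]; apply/qproj_eq0/asboolP.
by exists (fmap F f x); rewrite nt_natE.
Qed.

Definition coker_map : {additive coker (s A) -> coker (s B)} :=
  qlift coker_mapP.

Lemma coker_mapE (y : G A) :
  coker_map (qproj (im_pred (s A)) y) = qproj (im_pred (s B)) (fmap G f y).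
Proof. exact: qliftE. Qed.

End CokerMap.

Lemma coker_ind (A : C) (P : coker (s A) -> Prop) :
  (forall y, P (qproj (im_pred (s A)) y)) -> forall z, P z.
Proof. by move=> Pq z; have [y <-] := qproj_surj z. Qed.

Definition coker_functor : afunctor C Ab.
Proof.
refine (@AFunctor C Ab (fun A => coker (s A)) (fun _ _ f => coker_map f) _ _ _).
- move=> A; apply: additive_ext; apply: coker_ind => y.
  by apply: (etrans (coker_mapE (idm A) y)); rewrite fmap_idE.
- move=> A B D g f; apply: additive_ext; apply: coker_ind => y.
  apply: (etrans (coker_mapE (g ∘ f) y)); rewrite fmap_compE.
  by apply: esym; apply: (etrans (congr1 (coker_map g) (coker_mapE f y)));
    apply: coker_mapE.
- move=> A B f g; apply: additive_ext; apply: coker_ind => y.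
  apply: (etrans (coker_mapE (f ⊕ g) y)); rewrite fmap_addE raddfD.
  by apply: esym; congr (_ + _); apply: coker_mapE.
Defined.

Lemma coker_proj_nat (A B : C) (f : hom A B) :
  (qproj (im_pred (s B)) : hom (G B) (coker_functor B)) ∘ fmap G f =
  fmap coker_functor f ∘ (qproj (im_pred (s A)) : hom (G A) (coker_functor A)).
Proof. by apply: additive_ext => y; apply: esym; apply: coker_mapE. Qed.

Definition coker_proj : nattrans G coker_functor :=
  @NatTrans C Ab G coker_functor (fun A => qproj (im_pred (s A))) coker_proj_nat.

End KernelCokernelFunctors.

Definition exact_at (C : preadditive) (F G H : afunctor C Ab)
    (s : nattrans F G) (t : nattrans G H) : Prop :=
  forall (A : C) (y : G A), t A y = 0 <-> exists x, s A x = y.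

Definition epi (C : preadditive) (F G : afunctor C Ab) (s : nattrans F G) : Prop :=
  forall (A : C) (y : G A), exists x, s A x = y.

Lemma linear_ext (R : pzRingType) (M N : lmodType R) (f g : {linear M -> N}) :
  f =1 g -> f = g.
Proof.
case: f g => f [[fP] [fQ]] [g [[gP] [gQ]]] /= fg.
have {}fg : f = g by apply: funext.
case: _ / fg gP gQ => gP gQ.
by rewrite (Prop_irrelevance fP gP) (Prop_irrelevance fQ gQ).
Qed.

Section HomGroup.
Variables (R : pzRingType) (M N : lmodType R).
Implicit Types f g : {linear M -> N}.

HB.instance Definition _ := gen_eqMixin {linear M -> N}.
HB.instance Definition _ := gen_choiceMixin {linear M -> N}.

Definition lin_zero : {linear M -> N} := \0.
Definition lin_opp f : {linear M -> N} := \- f.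
Definition lin_add f g : {linear M -> N} := f \+ g.

Lemma lin_addA : associative lin_add.
Proof. by move=> f g h; apply: linear_ext => x /=; rewrite addrA. Qed.
Lemma lin_addC : commutative lin_add.
Proof. by move=> f g; apply: linear_ext => x /=; rewrite addrC. Qed.
Lemma lin_add0 : left_id lin_zero lin_add.
Proof. by move=> f; apply: linear_ext => x /=; rewrite add0r. Qed.
Lemma lin_addN : left_inverse lin_zero lin_opp lin_add.
Proof. by move=> f; apply: linear_ext => x /=; rewrite addNr. Qed.
HB.instance Definition _ :=
  GRing.isZmodule.Build {linear M -> N} lin_addA lin_addC lin_add0 lin_addN.

End HomGroup.

Definition Mod (R : pzRingType) : preadditive.
Proof.
refine (@Preadditive (lmodType R) (fun M N => {linear M -> N})
  (fun M => idfun) (fun M N P g f => g \o f)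
  (fun M N => 0) (fun M N f => - f) (fun M N f g => f + g)
  _ _ _ _ _ _ _ _ _).
- by move=> M N f; apply: linear_ext.
- by move=> M N f; apply: linear_ext.
- by move=> M N P Q h g f; apply: linear_ext.
- by move=> M N f g h; rewrite addrA.
- by move=> M N f g; rewrite addrC.
- by move=> M N f; rewrite add0r.
- by move=> M N f; rewrite addNr.
- by move=> M N P g g' f; apply: linear_ext.
- by move=> M N P g f f'; apply: linear_ext => x /=; rewrite raddfD.
Defined.

Definition fin_presented (R : pzRingType) (M : lmodType R) : Prop :=
  exists (m n : nat) (g : {linear 'rV[R]_m -> 'rV[R]_n})
         (f : {linear 'rV[R]_n -> M}),
    (forall y, exists x, f x = y) /\
    (forall x, f x = 0 <-> exists z, g z = x).

Definition injective_module (R : pzRingType) (I : lmodType R) : Prop :=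
  forall (M N : lmodType R) (i : {linear M -> N}) (f : {linear M -> I}),
    injective i -> exists g : {linear N -> I}, forall x, g (i x) = f x.

Definition essential (R : pzRingType) (M I : lmodType R) (i : {linear M -> I}) :
    Prop :=
  forall S : {pred I}, submod_closed S ->
    (exists2 y, y \in S & y != 0) ->
    exists x, i x \in S /\ i x != 0.

Definition injective_envelope (R : pzRingType) (M I : lmodType R)
    (i : {linear M -> I}) : Prop :=
  [/\ injective i, injective_module I & essential i].

Definition left_FPE (L : pzRingType) : Prop :=
  exists (I : lmodType L) (i : {linear L^o -> I}),
    injective_envelope i /\ fin_presented I.

Section Tensor.
Variables (L : pzRingType) (A : lmodType L^c) (M : lmodType L).

Definition tensor_free : zmodType := {freeg (A * M)%type}.
Definition tgen (a : A) (m : M) : tensor_free := << (a, m) >>.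

Definition tensor_closed (S : {pred tensor_free}) : Prop :=
  [/\ zmod_closed S,
      forall a a' m, tgen (a + a') m - tgen a m - tgen a' m \in S,
      forall a m m', tgen a (m + m') - tgen a m - tgen a m' \in S
    & forall (r : L) a m, tgen ((r : L^c) *: a) m - tgen a (r *: m) \in S].

(* The subgroup generated by the bilinearity and balancing relations. *)
Definition tensor_rel : {pred tensor_free} :=
  fun x => `[< forall S : {pred tensor_free}, tensor_closed S -> x \in S >].

Lemma tensor_rel_zmod_closed : zmod_closed tensor_rel.
Proof.
split; first by apply/asboolP => S [[]].
move=> x y /asboolP xP /asboolP yP; apply/asboolP => S Scl.
by have [[_ SB] _ _ _] := Scl; apply: SB; [apply: xP | apply: yP].
Qed.
HB.instance Definition _ :=
  GRing.isZmodClosed.Build tensor_free tensor_rel tensor_rel_zmod_closed.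

Definition tensor : zmodType := Quotient.quot tensor_rel.

Definition tens (a : A) (m : M) : tensor := qproj tensor_rel (tgen a m).

Lemma tensDl a a' m : tens (a + a') m = tens a m + tens a' m.
Proof.
apply/eqP; rewrite -subr_eq0 opprD addrA -!raddfB; apply/eqP/qproj_eq0.
by apply/asboolP => S [].
Qed.

Lemma tensDr a m m' : tens a (m + m') = tens a m + tens a m'.
Proof.
apply/eqP; rewrite -subr_eq0 opprD addrA -!raddfB; apply/eqP/qproj_eq0.
by apply/asboolP => S [].
Qed.

Lemma tensZ (r : L) a m : tens ((r : L^c) *: a) m = tens a (r *: m).
Proof.
apply/eqP; rewrite -subr_eq0 -raddfB; apply/eqP/qproj_eq0.
by apply/asboolP => S [].
Qed.


Variables (V : zmodType) (f : A -> M -> V).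

Record balanced : Prop := Balanced {
  balDl : forall a a' m, f (a + a') m = f a m + f a' m;
  balDr : forall a m m', f a (m + m') = f a m + f a m';
  balZ : forall (r : L) a m, f ((r : L^c) *: a) m = f a (r *: m)
}.

Definition free_lift (x : tensor_free) : V :=
  fglift (fun p => f p.1 p.2 : zmodule V) x.

Lemma free_lift_additive : zmod_morphism free_lift.
Proof. exact: (@lift_is_additive int (A * M)%type (zmodule V)). Qed.
HB.instance Definition _ :=
  GRing.isZmodMorphism.Build tensor_free V free_lift free_lift_additive.

Lemma free_liftE a m : free_lift (tgen a m) = f a m.
Proof. by rewrite /free_lift liftU scale1r. Qed.

Lemma free_lift_rel : balanced -> forall x, x \in tensor_rel -> free_lift x = 0.
Proof.
move=> [fDl fDr fZ] x /asboolP xP; apply/eqP.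
suff /xP : tensor_closed (ker_pred free_lift) by [].
split; first exact: ker_zmod_closed.
- by move=> a a' m; rewrite unfold_in !raddfB /= !free_liftE fDl addrAC addrK subrr.
- by move=> a m m'; rewrite unfold_in !raddfB /= !free_liftE fDr addrAC addrK subrr.
- by move=> r a m; rewrite unfold_in raddfB /= !free_liftE fZ subrr.
Qed.

Definition tensor_lift (fb : balanced) : {additive tensor -> V} :=
  qlift (free_lift_rel fb).

Lemma tensor_liftE fb a m : tensor_lift fb (tens a m) = f a m.
Proof. by rewrite -(free_liftE a m); apply: qliftE. Qed.

End Tensor.

Lemma tensor_ext (L : pzRingType) (A : lmodType L^c) (M : lmodType L)
    (V : zmodType) (g h : {additive tensor A M -> V}) :
  (forall a m, g (tens a m) = h (tens a m)) -> g = h.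
Proof.
move=> gh; apply: additive_ext => z; have [x <-] := qproj_surj z.
pose g' : {additive tensor_free A M -> V} := g \o qproj (@tensor_rel L A M).
pose h' : {additive tensor_free A M -> V} := h \o qproj (@tensor_rel L A M).
change (g' x = h' x); rewrite -(freeg_sumE x) (raddf_sum g') (raddf_sum h').
apply: eq_bigr => -[a m] _; set k := coeff _ _.
have -> : << k *g (a, m) >> = tgen a m *~ k by rewrite /tgen freegU_mulz intz.
by rewrite (raddfMz g') (raddfMz h'); congr (_ *~ _); apply: gh.
Qed.

Section TensorMap.
Variables (L : pzRingType) (A A' : lmodType L^c) (M M' : lmodType L).
Variables (u : {linear A -> A'}) (h : {linear M -> M'}).

Lemma tensor_map_balanced : balanced (fun a m => tens (u a) (h m)).
Proof.
split=> [a a' m|a m m'|r a m]; rewrite ?raddfD ?tensDl ?tensDr //.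
by rewrite !linearZ /= tensZ.
Qed.

Definition tensor_map : {additive tensor A M -> tensor A' M'} :=
  tensor_lift tensor_map_balanced.

Lemma tensor_mapE a m : tensor_map (tens a m) = tens (u a) (h m).
Proof. exact: tensor_liftE. Qed.

End TensorMap.

Section TensorFunctor.
Variable L : pzRingType.

Definition Tens (M : Mod L) : afunctor (Mod L^c) Ab.
Proof.
refine (@AFunctor (Mod L^c) Ab (fun A => tensor A M)
  (fun A B u => tensor_map u (idm M)) _ _ _).
- by move=> A; apply: tensor_ext => a m; apply: tensor_mapE.
- move=> A B D v u; apply: tensor_ext => a m.
  rewrite tensor_mapE; apply: esym.
  apply: (etrans (congr1 (tensor_map v (idm M)) (tensor_mapE u (idm M) a m))).
  exact: tensor_mapE.
- move=> A B u v; apply: tensor_ext => a m; rewrite tensor_mapE tensDl.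
  by apply: esym; congr (_ + _); apply: tensor_mapE.
Defined.

Lemma Tens_map_nat (M N : Mod L) (h : hom M N) (A B : Mod L^c) (u : hom A B) :
  (tensor_map (idm B) h : hom (Tens M B) (Tens N B)) ∘ fmap (Tens M) u =
  fmap (Tens N) u ∘ (tensor_map (idm A) h : hom (Tens M A) (Tens N A)).
Proof.
apply: tensor_ext => a m.
apply: (etrans (congr1 (tensor_map (idm B) h) (tensor_mapE u (idm M) a m))).
rewrite tensor_mapE; apply: esym.
apply: (etrans (congr1 (tensor_map u (idm N)) (tensor_mapE (idm A) h a m))).
exact: tensor_mapE.
Qed.

Definition Tens_map (M N : Mod L) (h : hom M N) : nattrans (Tens M) (Tens N) :=
  @NatTrans (Mod L^c) Ab (Tens M) (Tens N) (fun A => tensor_map (idm A) h)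
    (@Tens_map_nat M N h).

End TensorFunctor.

Section HomFunctor.
Variable L : pzRingType.

Section PostComposition.
Variables (M X Y : lmodType L).

Definition postcomp (f : {linear X -> Y}) (g : {linear M -> X}) :
  {linear M -> Y} := f \o g.
Lemma postcomp_additive f : zmod_morphism (postcomp f).
Proof. by move=> g h; apply: linear_ext => x; rewrite /= raddfB. Qed.
HB.instance Definition _ f :=
  GRing.isZmodMorphism.Build {linear M -> X} {linear M -> Y}
    (postcomp f) (postcomp_additive f).

End PostComposition.

Section PreComposition.
Variables (M N X : lmodType L) (h : {linear M -> N}).

Definition precomp (g : {linear N -> X}) : {linear M -> X} := g \o h.
Lemma precomp_additive : zmod_morphism precomp.
Proof. by move=> f g; apply: linear_ext. Qed.
HB.instance Definition _ :=
  GRing.isZmodMorphism.Build {linear N -> X} {linear M -> X}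
    precomp precomp_additive.

End PreComposition.

Definition Hom (M : Mod L) : afunctor (Mod L) Ab.
Proof.
refine (@AFunctor (Mod L) Ab (fun X => {linear M -> X} : zmodType)
  (fun X Y f => postcomp f) _ _ _).
- by move=> X; apply: additive_ext => g; apply: linear_ext.
- by move=> X Y Z g f; apply: additive_ext => k; apply: linear_ext.
- by move=> X Y f g; apply: additive_ext => k; apply: linear_ext.
Defined.

Lemma Hom_map_nat (M N : Mod L) (h : hom M N) (X Y : Mod L) (f : hom X Y) :
  (precomp h : hom (Hom N Y) (Hom M Y)) ∘ fmap (Hom N) f =
  fmap (Hom M) f ∘ (precomp h : hom (Hom N X) (Hom M X)).
Proof. by apply: additive_ext => g; apply: linear_ext. Qed.

Definition Hom_map (M N : Mod L) (h : hom M N) : nattrans (Hom N) (Hom M) :=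
  @NatTrans (Mod L) Ab (Hom N) (Hom M) (fun X => precomp h)
    (@Hom_map_nat M N h).

Definition fp_functor (F : afunctor (Mod L) Ab) : Prop :=
  exists (X Y : Mod L) (s : nattrans (Hom Y) (Hom X)) (t : nattrans (Hom X) F),
    exact_at s t /\ epi t.

Lemma Hom_fp (M : Mod L) : fp_functor (Hom M).
Proof.
exists M, M, (nt_zero (Hom M) (Hom M)), (nt_id (Hom M)); split; last first.
  by move=> X f; exists f.
by move=> X f; split=> [f0|[g <-] //]; exists 0; apply: esym.
Qed.

Lemma coker_Hom_fp (M N : Mod L) (h : hom M N) :
  fp_functor (coker_functor (Hom_map h)).
Proof.
exists M, N, (Hom_map h), (coker_proj (Hom_map h)); split=> [X f|X z].
  by rewrite (qproj_eq0 _ f); split=> [/asboolP|fP]; last exact/asboolP.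
exact: qproj_surj.
Qed.

End HomFunctor.

Section AGJ.
Variable L : pzRingType.

(* fp(Mod(L^op), Ab) *)
Definition fpMod : preadditive :=
  @full_subcat (functor_cat (Mod L) Ab) (@fp_functor L).

(* (mod(L), Ab) *)
Definition modAb : preadditive :=
  functor_cat (@full_subcat (Mod L^c) (@fin_presented L^c)) Ab.

Definition fpHom (M : Mod L) : fpMod :=
  @FullOb (functor_cat (Mod L) Ab) _ (Hom M) (Hom_fp M).

Definition modTens (M : Mod L) : modAb := restrict _ (Tens M).

Definition is_AGJ (D : cofunctor fpMod modAb) : Prop :=
  exact_cofunctor D /\
  exists theta : forall M : Mod L, hom (D (fpHom M)) (modTens M),
    (forall M, is_iso (theta M)) /\
    (forall (M N : Mod L) (h : hom M N),
       theta N ∘ cmap D (Hom_map h : hom (fpHom N) (fpHom M)) =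
       (restrict_nt _ (Tens_map h) : hom (modTens M) (modTens N)) ∘ theta M).

Variables (I : Mod L) (i : {linear L^o -> I}).

(* Applied to the injective envelope [i] of the left module L. *)
Definition torsion : afunctor (Mod L^c) Ab := ker_functor (Tens_map i).

Definition torsion_fp : modAb := restrict _ torsion.

Definition cotorsion : fpMod :=
  @FullOb (functor_cat (Mod L) Ab) _
    (coker_functor (Hom_map i)) (coker_Hom_fp i).

End AGJ.

(* Main.v *)
(** The first step is that [q X] is isomorphic to [Hom (s, _ ⊗ X)], naturally in
    the left module [X]. Since the injective envelope [I] of the ring is finitely
    presented, [s A = {a | a ⊗ i 1 = 0}] is a quotient of [Hom (U, _)] for a
    finitely presented right module [U] with a universal torsion element [u], and
    the kernel of [Hom (U, _) -> s] is [Hom (U / u, _)]. A transformation from [s]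
    to [_ ⊗ X] is thus an element of the kernel of [U ⊗ X -> (U / u) ⊗ X], that is
    an element [u ⊗ x], and [u ⊗ x = 0] exactly when the map [1 |-> x] factors
    through [I].

    Exactness of [D_A] embeds [s] into [_ ⊗ L] as [D_A q], the kernel of [_ ⊗ i].
    Composing with [s -> D_A q] maps [Hom (F, q)] to [Hom (s, D_A F)]; this is a
    bijection for representable [F] by the first step, hence for every finitely
    presented [F], because [D_A] turns a presentation of [F] into a kernel.
    Yoneda's lemma then gives [q = D_R s]. *)

From HB Require Import structures.
From mathcomp Require Import all_boot all_order all_algebra.
From mathcomp Require Import boolp.
Require Import Defs.

Set Implicit Arguments.
Unset Strict Implicit.
Unset Printing Implicit Defensive.

Import GRing.Theory.
Local Open Scope ring_scope.

(** * Linear maps out of the free modules ['rV[R]_p] *)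

Section RowCombination.
Variables (R : pzRingType) (N : lmodType R) (p : nat).

Definition row_comb (y : 'I_p -> N) (w : 'rV[R]_p) : N :=
  \sum_j w 0 j *: y j.

Lemma row_comb_linear y : linear (row_comb y).
Proof.
move=> r v w; rewrite /row_comb scaler_sumr -big_split; apply: eq_bigr => j _.
by rewrite !mxE scalerDl scalerA.
Qed.
HB.instance Definition _ y :=
  GRing.isLinear.Build R 'rV[R]_p N _ (row_comb y) (row_comb_linear y).

Lemma row_comb_delta y j : row_comb y 'e_j = y j.
Proof.
rewrite /row_comb (bigD1 j) //= mxE !eqxx scale1r big1 ?addr0 // => k kj.
by rewrite mxE (negPf kj) scale0r.
Qed.

Lemma linear_rowE (f : {linear 'rV[R]_p -> N}) w :
  f w = \sum_j w 0 j *: f 'e_j.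
Proof.
rewrite {1}(row_sum_delta w) linear_sum; apply: eq_bigr => j _.
by rewrite linearZ.
Qed.

Lemma linear_row_eq0 (f : {linear 'rV[R]_p -> N}) :
  (forall j, f 'e_j = 0) -> forall w, f w = 0.
Proof.
by move=> f0 w; rewrite linear_rowE big1 // => j _; rewrite f0 scaler0.
Qed.

End RowCombination.

(** * The cokernel of a linear map as a module *)

Section ModuleCokernel.
Variables (R : pzRingType) (M N : lmodType R) (g : {linear M -> N}).

Definition mod_coker : Type := coker g.
HB.instance Definition _ := GRing.Zmodule.on mod_coker.

Definition mod_proj : N -> mod_coker := qproj (im_pred g).
HB.instance Definition _ := GRing.Additive.on mod_proj.

Lemma mod_proj_eq0 x : mod_proj x = 0 <-> exists y, g y = x.
Proof.
split=> [/(qproj_eq0 (im_pred g) x).1 /asboolP //|gy].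
by apply/(qproj_eq0 (im_pred g) x)/asboolP.
Qed.

Lemma mod_proj_surj z : exists x, mod_proj x = z.
Proof. exact: qproj_surj. Qed.

Definition scale_rep (r : R) : {additive N -> coker g} :=
  @qproj _ (im_pred g) \o *:%R r.

Lemma scale_rep_im r x : x \in im_pred g -> scale_rep r x = 0.
Proof.
move=> /asboolP[y <-]; apply/mod_proj_eq0.
by exists (r *: y); rewrite linearZ.
Qed.

Definition mod_coker_scale (r : R) (z : mod_coker) : mod_coker :=
  qlift (scale_rep_im r) z.

Lemma mod_coker_scaleE r x : mod_coker_scale r (mod_proj x) = mod_proj (r *: x).
Proof. exact: qliftE. Qed.

Lemma mod_coker_scaleA a b v :
  mod_coker_scale a (mod_coker_scale b v) = mod_coker_scale (a * b) v.
Proof.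
by have [x <-] := mod_proj_surj v; rewrite !mod_coker_scaleE scalerA.
Qed.
Lemma mod_coker_scale1 : left_id 1 mod_coker_scale.
Proof.
by move=> v; have [x <-] := mod_proj_surj v; rewrite mod_coker_scaleE scale1r.
Qed.
Lemma mod_coker_scaleDr : right_distributive mod_coker_scale +%R.
Proof. by move=> r u v; apply: raddfD. Qed.
Lemma mod_coker_scaleDl v : {morph mod_coker_scale^~ v : a b / a + b}.
Proof.
move=> a b; have [x <-] := mod_proj_surj v.
by rewrite !mod_coker_scaleE scalerDl raddfD.
Qed.
HB.instance Definition _ := GRing.Zmodule_isLmodule.Build R mod_coker
  mod_coker_scaleA mod_coker_scale1 mod_coker_scaleDr mod_coker_scaleDl.

Lemma mod_proj_scalable : scalable mod_proj.
Proof. by move=> r x; rewrite -mod_coker_scaleE. Qed.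
HB.instance Definition _ :=
  GRing.isScalable.Build R N mod_coker _ mod_proj mod_proj_scalable.

End ModuleCokernel.

(** * Factoring maps through surjections and injections *)

Section Factorization.

Lemma linear_eqE (R : pzRingType) (M N : lmodType R) (f g : {linear M -> N}) :
  f = g -> f =1 g.
Proof. by move=> ->. Qed.

Lemma additive_factor (U V W : zmodType) (f : {additive U -> V})
    (h : {additive U -> W}) :
  (forall y, exists x, f x = y) -> (forall x, f x = 0 -> h x = 0) ->
  exists k : {additive V -> W}, forall x, k (f x) = h x.
Proof.
move=> /choice[s sK] fh.
have kE x : h (s (f x)) = h x.
  by apply/subr0_eq; rewrite -raddfB; apply: fh; rewrite raddfB sK subrr.
have kB : zmod_morphism (h \o s).
  move=> y z; rewrite -(sK y) -(sK z) -raddfB /= !kE raddfB.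
  by rewrite -[y in RHS]sK -[z in RHS]sK !kE.
pose kM := GRing.isZmodMorphism.Build _ _ _ kB.
pose k : {additive V -> W} := HB.pack (h \o s) kM.
by exists k.
Qed.

Lemma linear_factor (R : pzRingType) (M N P : lmodType R)
    (f : {linear M -> N}) (h : {linear M -> P}) :
  (forall y, exists x, f x = y) -> (forall x, f x = 0 -> h x = 0) ->
  exists k : {linear N -> P}, forall x, k (f x) = h x.
Proof.
move=> fS fh; have [k kE] := additive_factor fS fh.
have {}kE x : k (f x) = h x := kE x.
have kL : linear k.
  move=> r y z; have [u <-] := fS y; have [v <-] := fS z.
  by rewrite -(linearP f) !kE (linearP h).
pose kM := GRing.isLinear.Build _ _ _ _ _ kL.
pose k' : {linear N -> P} := HB.pack (k : N -> P) kM.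
by exists k'.
Qed.

Lemma additive_factor_inj (U V W : zmodType) (f : {additive U -> V})
    (h : {additive W -> V}) :
  injective f -> (forall w, exists x, f x = h w) ->
  exists k : {additive W -> U}, forall w, f (k w) = h w.
Proof.
move=> fI /choice[k kE].
have kB : zmod_morphism k.
  by move=> v w; apply: fI; rewrite raddfB !kE raddfB.
pose kM := GRing.isZmodMorphism.Build _ _ _ kB.
pose k' : {additive W -> U} := HB.pack k kM.
by exists k'.
Qed.

End Factorization.

(** * Tensoring with a presented module, in coordinates *)

Section Coordinates.
Variables (R : pzRingType) (B : lmodType R) (X : zmodType).
Variables (act : R -> X -> X).
Hypothesis actDl : forall r s x, act (r + s) x = act r x + act s x.
Hypothesis actDr : forall r x y, act r (x + y) = act r x + act r y.
Hypothesis act1 : forall x, act 1 x = x.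
Hypothesis actM : forall r s x, act (r * s) x = act s (act r x).
Variables (n p : nat) (g : {linear 'rV[R]_n -> 'rV[R]_p}).
Variable f : {linear 'rV[R]_p -> B}.
Hypothesis f_surj : forall b, exists w, f w = b.
Hypothesis f_ker : forall w, f w = 0 -> exists v, g v = w.

Lemma act0 x : act 0 x = 0.
Proof. by apply: (addrI (act 0 x)); rewrite -actDl !addr0. Qed.

Lemma act_sum I (r : seq I) (F : I -> R) x :
  act (\sum_(k <- r) F k) x = \sum_(k <- r) act (F k) x.
Proof. by apply: (big_morph (act^~ x) _ (act0 x)) => a b; apply: actDl. Qed.

(** [Q] is the cokernel of the map from [X^n] to [X^p] given by the matrix of [g], which is the
    value that right exactness predicts for the tensor product of [B] and [X]. The action on [X] is
    an abstract [act], with products reversed, so that the presented module may be the left or the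
    right factor. *)
Lemma coordinate_map :
  exists (Q : zmodType) (q : {additive {ffun 'I_p -> X} -> Q}) (F : B -> X -> Q),
  [/\ forall x, q x = 0 -> exists y, forall j,
        x j = \sum_i act (g 'e_i 0 j) (y i),
      forall w x, F (f w) x = q [ffun j => act (w 0 j) x],
      forall b b' x, F (b + b') x = F b x + F b' x,
      forall b x x', F b (x + x') = F b x + F b x'
    & forall r b x, F (r *: b) x = F b (act r x)].
Proof.
pose G (y : {ffun 'I_n -> X}) : {ffun 'I_p -> X} :=
  [ffun j => \sum_i act (g 'e_i 0 j) (y i)].
have GB : zmod_morphism G.
  move=> y z; apply/ffunP => j; rewrite !ffunE -sumrB; apply: eq_bigr => i _.
  rewrite !ffunE; apply/(addIr (act (g 'e_i 0 j) (z i))).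
  by rewrite -actDr !subrK.
pose GM := GRing.isZmodMorphism.Build _ _ _ GB.
pose G' : {additive {ffun 'I_n -> X} -> {ffun 'I_p -> X}} := HB.pack G GM.
pose q : {additive _ -> coker G'} := @qproj _ (im_pred G').
pose row (w : 'rV[R]_p) x : {ffun 'I_p -> X} := [ffun j => act (w 0 j) x].
have row_q v x : q (row (g v) x) = 0.
  apply/qproj_eq0/asboolP; exists [ffun i => act (v 0 i) x].
  apply/ffunP => j; rewrite !ffunE linear_rowE summxE act_sum.
  by apply: eq_bigr => i _; rewrite ffunE mxE actM.
have rowD v w x : row (v + w) x = row v x + row w x.
  by apply/ffunP => j; rewrite !ffunE mxE actDl.
have rowDr w x y : row w (x + y) = row w x + row w y.
  by apply/ffunP => j; rewrite !ffunE actDr.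
have [s sK] := choice f_surj.
(* The choice of lift [s] is harmless: two lifts differ by some [g v], whose row lies in the image
   of [G]. *)
have FE w x : q (row (s (f w)) x) = q (row w x).
  have /f_ker[v gv] : f (s (f w) - w) = 0 by rewrite linearB sK subrr.
  by rewrite -(subrK w (s (f w))) -gv rowD raddfD row_q add0r.
exists (coker G'), q, (fun b x => q (row (s b) x)); split=> //.
- move=> x /qproj_eq0/asboolP[y <-]; exists y => j; exact: ffunE.
- move=> b b' x; rewrite -(sK b) -(sK b') -linearD !FE.
  by rewrite rowD raddfD.
- by move=> b x x'; rewrite rowDr raddfD.
- move=> r b x; rewrite -(sK b) -linearZ !FE; congr (q _).
  by apply/ffunP => j; rewrite !ffunE mxE actM.
Qed.

Lemma row_delta (x : 'I_p -> X) :
  \sum_j [ffun k => act (('e_j : 'rV[R]_p) 0 k) (x j)] = finfun x.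
Proof.
apply/ffunP => k; rewrite sum_ffunE ffunE (bigD1 k) //= ffunE mxE !eqxx act1.
rewrite big1 ?addr0 // => j jk.
by rewrite ffunE mxE eq_sym (negPf jk) andbF act0.
Qed.

End Coordinates.

(** * Generators and vanishing of tensors *)

Section TensorRelations.
Variable L : pzRingType.

Lemma tens0l (A : lmodType L^c) (M : lmodType L) (m : M) :
  tens 0 m = 0 :> tensor A M.
Proof. by apply: (addrI (tens 0 m)); rewrite -tensDl !addr0. Qed.

Lemma tensN (A : lmodType L^c) (M : lmodType L) (a : A) (m : M) :
  tens (- a) m = - tens a m.
Proof. by apply: (addrI (tens a m)); rewrite -tensDl !subrr tens0l. Qed.

Lemma tens0r (A : lmodType L^c) (M : lmodType L) (a : A) :
  tens a 0 = 0 :> tensor A M.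
Proof. by apply: (addrI (tens a 0)); rewrite -tensDr !addr0. Qed.

Lemma tens_suml (A : lmodType L^c) (M : lmodType L) J (r : seq J) (P : pred J)
    (F : J -> A) (m : M) :
  tens (\sum_(k <- r | P k) F k) m = \sum_(k <- r | P k) tens (F k) m.
Proof.
by apply: (big_morph (fun a => tens a m) _ (tens0l _ m)) => a b; apply: tensDl.
Qed.

Lemma tens_sumr (A : lmodType L^c) (M : lmodType L) J (r : seq J) (P : pred J)
    (a : A) (F : J -> M) :
  tens a (\sum_(k <- r | P k) F k) = \sum_(k <- r | P k) tens a (F k).
Proof.
by apply: (big_morph (fun m => tens a m) _ (tens0r _ a)) => m m'; apply: tensDr.
Qed.

(** Multiplication [a ⊗ r |-> a r] followed by [a |-> a ⊗ 1] fixes all generators, hence is the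
    identity. *)
Lemma tens_regular (A : lmodType L^c) (z : tensor A L^o) :
  exists a, z = tens a (1 : L^o).
Proof.
have bal : balanced (fun (a : A) (r : L^o) => (r : L^c) *: a).
  split=> [a a' m|a m m'|r a m]; first exact: scalerDr.
    exact: scalerDl.
  by rewrite scalerA.
have hB : zmod_morphism (fun a : A => tens a (1 : L^o)).
  by move=> a b; rewrite tensDl tensN.
pose hM := GRing.isZmodMorphism.Build _ _ _ hB.
pose h : {additive A -> tensor A L^o} :=
  HB.pack (fun a : A => tens a (1 : L^o)) hM.
exists (tensor_lift bal z).
pose T := tensor A L^o.
suff E : (h \o tensor_lift bal : {additive T -> T}) = idfun.
  exact: esym (congr1 (fun u : {additive T -> T} => u z) E).
apply: tensor_ext => a m /=.
apply: (etrans (congr1 h (tensor_liftE bal a m))).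
apply: (etrans (tensZ _ _ _)); congr (tens _ _); exact: mulr1.
Qed.

(** Sums of this shape form a subgroup [S]. The projection modulo [S] kills every pure tensor, so it
    is zero. *)
Lemma tens_fin_gen (B : lmodType L^c) (X : lmodType L) p
    (f : {linear 'rV[L^c]_p -> B}) (z : tensor B X) :
  (forall b, exists w, f w = b) ->
  exists x : 'I_p -> X, z = \sum_j tens (f 'e_j) (x j).
Proof.
move=> f_surj.
pose S : {pred tensor B X} :=
  fun z => `[< exists x : 'I_p -> X, z = \sum_j tens (f 'e_j) (x j) >].
have SB : zmod_closed S.
  split.
    by apply/asboolP; exists (fun=> 0); rewrite big1 // => j _; rewrite tens0r.
  move=> _ _ /asboolP[x ->] /asboolP[y ->]; apply/asboolP.
  exists (fun j => x j - y j); rewrite -sumrB; apply: eq_bigr => j _.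
  by apply: (addIr (tens (f 'e_j) (y j))); rewrite -tensDr !subrK.
pose SM := GRing.isZmodClosed.Build _ _ SB.
pose S' : zmodClosed (tensor B X) := HB.pack S SM.
apply/asboolP; change (z \in S').
apply/(@qproj_eq0 _ S').
pose T := tensor B X; pose Q := Quotient.quot S'.
suff E : (qproj S' : {additive T -> Q}) = \0.
  by have := congr1 (fun u : {additive T -> Q} => u z) E.
apply: tensor_ext => b x /=; apply/(@qproj_eq0 _ S')/asboolP.
have [w <-] := f_surj b; exists (fun j => (w 0 j : L) *: x).
rewrite linear_rowE tens_suml; apply: eq_bigr => j _.
by rewrite tensZ.
Qed.

(** The balanced map [F] of [coordinate_map] induces a map on the tensor product that sends the
    given sum to the class of the family [x] in [Q]; this class is zero only if [x] comes from the
    relations. *)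
Lemma tens_eq0_right (B : lmodType L^c) (X : lmodType L) n p
    (g : {linear 'rV[L^c]_n -> 'rV[L^c]_p}) (f : {linear 'rV[L^c]_p -> B})
    (x : 'I_p -> X) :
  (forall b, exists w, f w = b) ->
  (forall w, f w = 0 -> exists v, g v = w) ->
  \sum_j tens (f 'e_j) (x j) = 0 ->
  exists y : 'I_n -> X, forall j, x j = \sum_i (g 'e_i 0 j : L) *: y i.
Proof.
move=> f_surj f_ker xE; pose act (r : L^c) (x : X) := (r : L) *: x.
have aDl r s y : act (r + s) y = act r y + act s y by exact: scalerDl.
have aDr r y z : act r (y + z) = act r y + act r z by exact: scalerDr.
have a1 y : act 1 y = y by exact: scale1r.
have aM r s y : act (r * s) y = act s (act r y) by rewrite /act scalerA.
have [Q [q [F [qE FE FDl FDr FZ]]]] := coordinate_map aDl aDr aM f_surj f_ker.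
have bal : balanced F by split.
have := congr1 (tensor_lift bal) xE.
rewrite raddf0 raddf_sum (eq_bigr _ (fun _ _ => tensor_liftE bal _ _)).
rewrite (eq_bigr _ (fun _ _ => FE _ _)) -raddf_sum row_delta // => /qE[y yE].
by exists y => j; rewrite -yE ffunE.
Qed.

(** The mirror image of [tens_eq0_right]: the left factor of the tensor product now carries the
    coefficients, so [F] is used with its arguments exchanged. *)
Lemma tens_eq0_left (A : lmodType L^c) (I : lmodType L) n p
    (g : {linear 'rV[L]_n -> 'rV[L]_p}) (f : {linear 'rV[L]_p -> I})
    (a : 'I_p -> A) :
  (forall b, exists w, f w = b) ->
  (forall w, f w = 0 -> exists v, g v = w) ->
  \sum_j tens (a j) (f 'e_j) = 0 ->
  exists b : 'I_n -> A, forall j, a j = \sum_i (g 'e_i 0 j : L^c) *: b i.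
Proof.
move=> f_surj f_ker aE; pose act (r : L) (a : A) := (r : L^c) *: a.
have aDl r s y : act (r + s) y = act r y + act s y by exact: scalerDl.
have aDr r y z : act r (y + z) = act r y + act r z by exact: scalerDr.
have a1 y : act 1 y = y by exact: scale1r.
have aM r s y : act (r * s) y = act s (act r y) by rewrite /act scalerA.
have [Q [q [F [qE FE FDl FDr FZ]]]] := coordinate_map aDl aDr aM f_surj f_ker.
have bal : balanced (fun a b => F b a) by split=> // r b c; rewrite FZ.
have := congr1 (tensor_lift bal) aE.
rewrite raddf0 raddf_sum (eq_bigr _ (fun _ _ => tensor_liftE bal _ _)).
rewrite (eq_bigr _ (fun _ _ => FE _ _)) -raddf_sum row_delta // => /qE[y yE].
by exists y => j; rewrite -yE ffunE.
Qed.

End TensorRelations.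

(** * Modules presented by a matrix, and the test module for torsion *)

Section MatrixCokernel.
Variables (R : pzRingType) (n p : nat) (M : 'M[R]_(n, p)).
Let g : {linear 'rV[R]_n -> 'rV[R]_p} := mulmxr M.

Lemma mod_coker_fin_presented : fin_presented (mod_coker g).
Proof.
exists n, p, g, (mod_proj g); split; [exact: mod_proj_surj | exact: mod_proj_eq0].
Qed.

Lemma mulmxr_delta k j : (mulmxr M 'e_k : 'rV_p) 0 j = M k j.
Proof. by rewrite /= -rowE mxE. Qed.

End MatrixCokernel.

Section TorsionTest.
Variables (L : pzRingType) (I : lmodType L) (i1 : I).

(* The functor [A |-> {a | a ⊗ i1 = 0}] is a quotient of Hom(U, _): the test
   module U has generators u, b_1, .., b_m and the relations
   u c_k = \sum_j b_j G_jk which express [u ⊗ i1 = 0] when I is presented by the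
   matrix G and i1 is the class of the row c; V is U / u. *)
Lemma torsion_test : fin_presented I ->
  exists (U V : lmodType L^c) (u : U) (pi : {linear U -> V}),
  [/\ fin_presented U /\ fin_presented V,
      tens u i1 = 0 /\ pi u = 0,
      forall (A : lmodType L^c) (a : A), tens a i1 = 0 ->
        exists h : {linear U -> A}, h u = a,
      forall (X : lmodType L) (x : X), tens u x = 0 ->
        exists k : {linear I -> X}, k i1 = x
    & forall (X : lmodType L) (z : tensor U X),
        tensor_map pi (idfun : {linear X -> X}) z = 0 -> exists x, z = tens u x].
Proof.
move=> [m [n [g [f [f_surj f_ker]]]]].
have [c fc] := f_surj i1.
(* Row k of [MU] is (c_k, -G_1k, .., -G_mk), the k-th relation of U. Dropping the column of [u]
   gives [MV], the relations of U / u. *)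
pose col : 'cV[L^c]_n := \col_k (c 0 k : L^c).
pose MV : 'M[L^c]_(n, m) := \matrix_(k, j) - (g 'e_j 0 k : L^c).
pose MU : 'M[L^c]_(n, 1 + m) := row_mx col MV.
pose U : lmodType L^c := mod_coker (mulmxr MU : {linear 'rV_n -> 'rV_(1 + m)}).
pose V : lmodType L^c := mod_coker (mulmxr MV : {linear 'rV_n -> 'rV_m}).
pose pU : {linear 'rV[L^c]_(1 + m) -> U} := mod_proj _.
pose pV : {linear 'rV[L^c]_m -> V} := mod_proj _.
have pUS b : exists w, pU w = b by exact: mod_proj_surj.
have pVS b : exists w, pV w = b by exact: mod_proj_surj.
have pUK w : pU w = 0 -> exists v, mulmxr MU v = w by move/mod_proj_eq0.
have pVK w : pV w = 0 -> exists v, mulmxr MV v = w by move/mod_proj_eq0.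
pose u : U := pU 'e_(lshift m ord0); pose b j : U := pU 'e_(rshift 1 j).
have i1E : i1 = \sum_k c 0 k *: f 'e_k by rewrite -fc linear_rowE.
have fg j : \sum_k g 'e_j 0 k *: f 'e_k = 0.
  by rewrite -linear_rowE; apply/f_ker; exists 'e_j.
have Urel (k : 'I_n) :
    (c 0 k : L^c) *: u = \sum_j (g 'e_j 0 k : L^c) *: b j.
  have : pU (mulmxr MU 'e_k) = 0 by apply/mod_proj_eq0; exists 'e_k.
  rewrite linear_rowE big_split_ord big_ord1 /= mulmxr_delta row_mxEl mxE.
  move/eqP; rewrite addr_eq0 -sumrN => /eqP ->; apply: eq_bigr => j _.
  by rewrite mulmxr_delta row_mxEr mxE scaleNr opprK.
(* Forgetting the coordinate of [u] carries [MU] to [MV], hence induces [pi]. *)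
pose rs (w : 'rV[L^c]_(1 + m)) : 'rV[L^c]_m := rsubmx w.
have rsB : linear rs by move=> r v w; rewrite /rs linearP.
pose rsM := GRing.isLinear.Build _ _ _ _ _ rsB.
pose rsL : {linear 'rV[L^c]_(1 + m) -> 'rV[L^c]_m} := HB.pack rs rsM.
have [pi piE] : exists pi : {linear U -> V}, forall w, pi (pU w) = pV (rs w).
  apply: (linear_factor (h := pV \o rsL)) => // w /pUK[v <-].
  apply/mod_proj_eq0; exists v.
  by rewrite /= /rs /MU mul_mx_row row_mxKr.
have rs0 : rs 'e_(lshift m ord0) = 0.
  by apply/rowP => j; rewrite !mxE eq_rlshift andbF.
have rsr j : rs 'e_(rshift 1 j) = 'e_j.
  by apply/rowP => k; rewrite !mxE eq_rshift.
exists U, V, u, pi; split.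
- by split; apply: mod_coker_fin_presented.
- split; last by rewrite piE rs0 raddf0.
  (* Moving scalars across: u ⊗ i1 = \sum_k u c_k ⊗ f e_k = \sum_j b_j ⊗ \sum_k G_jk f e_k, and each
     inner sum is a relation of I. *)
  rewrite i1E tens_sumr.
  rewrite (eq_bigr (fun k => \sum_j tens (b j) (g 'e_j 0 k *: f 'e_k))).
    by rewrite exchange_big big1 //= => j _; rewrite -tens_sumr fg tens0r.
  move=> k _; rewrite -tensZ Urel tens_suml; apply: eq_bigr => j _.
  exact: tensZ.
(* The vanishing of [a ⊗ i1] yields elements b'_j with a c_k = \sum_j b'_j G_jk. These are the
   relations of U, so u |-> a, b_j |-> b'_j defines [h]. *)
- move=> A a; rewrite i1E tens_sumr => a0.
  have [|b' bE] := tens_eq0_left (a := fun k => (c 0 k : L^c) *: a) f_surj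
    (fun w => (f_ker w).1).
    by rewrite -[RHS]a0; apply: eq_bigr => k _; rewrite tensZ.
  pose y (j : 'I_(1 + m)) := if split j is inr j' then b' j' else a.
  have yl : y (lshift m ord0) = a by rewrite /y (unsplitK (inl _ ord0)).
  have yr j : y (rshift 1 j) = b' j by rewrite /y (unsplitK (inr _ j)).
  have [w /pUK[v <-]|h hE] := linear_factor (h := row_comb y) pUS.
    apply: (linear_row_eq0 (f := row_comb y \o mulmxr MU)) v => k.
    rewrite [LHS]/= /row_comb big_split_ord big_ord1 /= mulmxr_delta row_mxEl mxE yl.
    rewrite bE -big_split big1 //= => j _.
    by rewrite mulmxr_delta row_mxEr mxE yr scaleNr subrr.
  by exists h; apply: (etrans (hE _)); rewrite /= row_comb_delta yl.
- move=> X x ux.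
  (* Written on the generators of U, [u ⊗ x] is the family (x, 0, .., 0). Its vanishing gives y_k
     with x = \sum_k c_k y_k and \sum_k G_jk y_k = 0, so f e_k |-> y_k is well defined on I and
     sends i1 to x. *)
  pose xs (j : 'I_(1 + m)) := if split j is inr j' then 0 else x.
  have xl : xs (lshift m ord0) = x by rewrite /xs (unsplitK (inl _ ord0)).
  have xr j : xs (rshift 1 j) = 0 by rewrite /xs (unsplitK (inr _ j)).
  have [|y yE] := tens_eq0_right (x := xs) pUS pUK.
    rewrite big_split_ord big_ord1 /= xl ux add0r big1 // => j _.
    by rewrite xr tens0r.
  have [w /f_ker[v <-]|k kE] := linear_factor (h := row_comb y) f_surj.
    apply: (linear_row_eq0 (f := row_comb y \o g)) v => j /=.
    have := yE (rshift 1 j); rewrite xr => /(congr1 -%R).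
    rewrite oppr0 -sumrN => E; apply: etrans (esym E); apply: eq_bigr => k _.
    by rewrite mulmxr_delta row_mxEr mxE scaleNr opprK.
  exists k; rewrite -fc kE -xl yE; apply: eq_bigr => j _.
  by rewrite mulmxr_delta row_mxEl mxE.
- move=> X z; have [x ->] := tens_fin_gen z pUS.
  rewrite raddf_sum big_split_ord big_ord1 => z0.
  have [|y yE] := tens_eq0_right (x := fun j => x (rshift 1 j)) pVS pVK.
    rewrite -[LHS]add0r -[RHS]z0; congr (_ + _).
      by rewrite tensor_mapE piE rs0 raddf0 tens0l.
    by apply: eq_bigr => j _; rewrite tensor_mapE piE rsr.
  (* In U / u the b-part vanishes, so x_j = - \sum_k G_jk y_k. Back in U, the relations turn \sum_j
     b_j ⊗ x_j into - u ⊗ \sum_k c_k y_k. *)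
  exists (x (lshift m ord0) - \sum_k c 0 k *: y k).
  rewrite big_split_ord big_ord1 tensDr; congr (_ + _).
  rewrite -sumrN tens_sumr.
  rewrite (eq_bigr (fun j => \sum_k tens (b j) (- (g 'e_j 0 k *: y k)))).
    rewrite exchange_big; apply: eq_bigr => k _ /=.
    rewrite -scalerN -tensZ Urel tens_suml; apply: eq_bigr => j _.
    by rewrite tensZ scalerN.
  move=> j _; rewrite yE tens_sumr; apply: eq_bigr => k _.
  by rewrite mulmxr_delta mxE scaleNr.
Qed.

End TorsionTest.

(** Two injective envelopes of [M] are isomorphic, so a finite presentation of one carries over to
    the other. *)
Lemma injective_envelope_fin_presented (R : pzRingType) (M I I' : lmodType R)
    (i : {linear M -> I}) (i' : {linear M -> I'}) :
  injective_envelope i -> injective_envelope i' -> fin_presented I' ->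
  fin_presented I.
Proof.
move=> [i_inj I_inj i_ess] [i'_inj I'_inj i'_ess] [m [n [g [f [f_surj f_ker]]]]].
(* A nonzero kernel of [h] would contain some [j x != 0] by essentiality, but [j' x = h (j x) = 0]
   forces [x = 0]. *)
have ess_inj (N N' P : lmodType R) (j : {linear N -> N'}) (j' : {linear N -> P})
    (h : {linear N' -> P}) :
    injective j' -> essential j -> (forall x, h (j x) = j' x) -> injective h.
  move=> j'_inj j_ess hj y z hyz; apply/eqP; rewrite -subr_eq0.
  apply/negPn/negP => yz.
  have [||x []] := j_ess (fun y => h y == 0).
  - split=> [|r u v]; rewrite !unfold_in ?linear0 // => /eqP hu /eqP hv.
    by rewrite linearP hu hv scaler0 addr0.
  - by exists (y - z) => //; rewrite unfold_in linearB hyz subrr.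
  rewrite unfold_in hj => /eqP x0; case/negP; apply/eqP.
  by rewrite -(linear0 j); congr (j _); apply: j'_inj; rewrite x0 linear0.
have [h hE] := I'_inj _ _ i i' i_inj.
have h_inj : injective h := ess_inj _ _ _ _ _ _ i'_inj i_ess hE.
(* The retraction [r] of [h] restricts to [i] along [i'], so it is injective by the same argument
   and inverts [h]. *)
have [r rE] := I_inj _ _ h idfun h_inj.
have r_inj : injective r.
  by apply: (ess_inj _ _ _ i' i) => // x; rewrite -hE rE.
exists m, n, g, (r \o f); split=> [y|x].
  by have [x fx] := f_surj (h y); exists x; rewrite /= fx rE.
rewrite -f_ker /=; split=> [rf0|->]; last exact: linear0.
by apply: r_inj; rewrite rf0 linear0.
Qed.

Local Open Scope cat_scope.

(** * Factorization and exactness for functors to abelian groups *)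

Section NaturalFactorization.
Variable C : preadditive.

Lemma nt_factor (F G H : afunctor C Ab) (t : nattrans F G) (h : nattrans F H) :
  epi t -> (forall A x, t A x = 0 -> h A x = 0) ->
  exists k : nattrans G H, forall A x, k A (t A x) = h A x.
Proof.
move=> t_epi th.
have kP A : exists k : {additive G A -> H A}, forall x, k (t A x) = h A x.
  exact: additive_factor (t_epi A) (th A).
have [k kE] : {k : forall A, {additive G A -> H A} |
    forall A x, k A (t A x) = h A x}.
  by exists (fun A => projT1 (cid (kP A))) => A x; case: cid.
have k_nat A B (f : hom A B) :
    (k B : hom (G B) (H B)) ∘ fmap G f = fmap H f ∘ k A.
  apply: additive_ext => y; have [x <-] := t_epi A y.
  change (k B (fmap G f (t A x)) = fmap H f (k A (t A x))).
  by rewrite -nt_natE !kE nt_natE.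
by exists (NatTrans (nt := fun A => k A : hom (G A) (H A)) k_nat).
Qed.

Lemma nt_factor_inj (F G H : afunctor C Ab) (s : nattrans F G)
    (h : nattrans H G) :
  (forall A, injective (s A)) -> (forall A y, exists x, s A x = h A y) ->
  exists k : nattrans H F, forall A y, s A (k A y) = h A y.
Proof.
move=> s_inj sh.
have kP A : exists k : {additive H A -> F A}, forall y, s A (k y) = h A y.
  exact: additive_factor_inj (@s_inj A) (sh A).
have [k kE] : {k : forall A, {additive H A -> F A} |
    forall A y, s A (k A y) = h A y}.
  by exists (fun A => projT1 (cid (kP A))) => A y; case: cid.
have k_nat A B (f : hom A B) :
    (k B : hom (H B) (F B)) ∘ fmap H f = fmap F f ∘ k A.
  apply: additive_ext => y; apply: (@s_inj B).
  change (s B (k B (fmap H f y)) = s B (fmap F f (k A y))).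
  by rewrite nt_natE !kE nt_natE.
by exists (NatTrans (nt := fun A => k A : hom (H A) (F A)) k_nat).
Qed.

Lemma nt_eqE (F G : afunctor C Ab) (s t : nattrans F G) :
  s = t -> forall A x, s A x = t A x.
Proof. by move=> ->. Qed.

Lemma nt_ext (F G : afunctor C Ab) (s t : nattrans F G) :
  (forall A x, s A x = t A x) -> s = t.
Proof. by move=> st; apply: nattrans_ext => A; apply: additive_ext. Qed.

Variable P : functor_cat C Ab -> Prop.

(** The universal factorizations are built pointwise among all functors, and fullness makes them
    morphisms of the subcategory, whatever [P] is. *)
Lemma pointwise_short_exact (F G H : full_subcat P)
    (s : hom F G) (t : hom G H) :
  (forall A, injective ((s : nattrans _ _) A)) ->
  exact_at (s : nattrans _ _) t -> epi (t : nattrans _ _) -> short_exact s t.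
Proof.
move=> s_inj st_ex t_epi.
have ts : t ∘ s = hzero F H.
  by apply: nt_ext => A x; apply/st_ex; exists x.
split; split=> // X h.
  move=> /nt_eqE th; have [|k kE] := nt_factor_inj (h := h) s_inj.
    by move=> A y; apply/st_ex/th.
  exists k; split=> [|k' /nt_eqE k'E]; first exact: nt_ext.
  by apply: nt_ext => A y; apply: s_inj; rewrite kE -k'E.
move=> /nt_eqE hs; have [|k kE] := nt_factor (h := h) t_epi.
  by move=> A y /st_ex[x <-]; apply: hs.
exists k; split=> [|k' /nt_eqE k'E]; first exact: nt_ext.
by apply: nt_ext => A y; have [x <-] := t_epi A y; rewrite kE -k'E.
Qed.

End NaturalFactorization.

(** * Torsion inside [_ ⊗ L], and its transformations to [_ ⊗ X] *)

Section KernelInclusion.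
Variables (C : preadditive) (F G : afunctor C Ab) (s : nattrans F G).

Lemma ker_val_additive (A : C) : zmod_morphism (@ker_val _ _ (s A)).
Proof. by []. Qed.
HB.instance Definition _ (A : C) :=
  GRing.isZmodMorphism.Build (ker (s A)) (F A) (@ker_val _ _ (s A))
    (@ker_val_additive A).

Definition ker_incl : nattrans (ker_functor s) F.
Proof.
refine (@NatTrans C Ab (ker_functor s) F (fun A => @ker_val _ _ (s A)) _).
by move=> A B f; apply: additive_ext.
Defined.

End KernelInclusion.

Section TorsionTransformations.
Variables (L : pzRingType) (I : Mod L) (i : {linear L^o -> I}).

Definition torsion_incl : hom (torsion_fp i) (modTens (L^o : lmodType L)) :=
  restrict_nt _ (ker_incl (Tens_map i)).

Definition modTens_map (M N : Mod L) (h : hom M N) :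
    hom (modTens M) (modTens N) :=
  restrict_nt _ (Tens_map h).

Lemma modTens_map_torsion_incl :
  modTens_map i ∘ torsion_incl = hzero (torsion_fp i) (modTens I).
Proof. by apply: nt_ext => A [z zK]; apply/eqP. Qed.

Lemma mem_torsion (A : lmodType L^c) (a : A) :
  (tens a (1 : L^o) \in ker_pred (Tens_map i A)) = (tens a (i 1) == 0).
Proof. by rewrite unfold_in /= -[tens a (i 1)](tensor_mapE idfun i). Qed.

Definition mul_right (X : lmodType L) (x : X) (r : L^o) : X := (r : L) *: x.
Lemma mul_right_linear (X : lmodType L) (x : X) : linear (mul_right x).
Proof. by move=> r a b; rewrite /mul_right scalerDl scalerA. Qed.
HB.instance Definition _ (X : lmodType L) (x : X) :=
  GRing.isLinear.Build L L^o X _ (mul_right x) (mul_right_linear x).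

Hypothesis I_fp : fin_presented I.

(** Every torsion element is the image of [u ⊗ 1] under some map out of U, so [s] is determined by
    its value there. Naturality along [pi], which kills [u], puts this value in the kernel of
    [U ⊗ X -> V ⊗ X], so it has the form [u ⊗ x]. *)
Lemma torsion_trans_mul (X : Mod L) (s : hom (torsion_fp i) (modTens X)) :
  exists x : {linear L^o -> X}, s = modTens_map x ∘ torsion_incl.
Proof.
have [U [V [u [pi [[U_fp V_fp] [u0 piu0] u_univ _ pi_ker]]]]] :=
  torsion_test (i 1) I_fp.
pose U' : @full_subcat (Mod L^c) (@fin_presented L^c) :=
   @FullOb (Mod L^c) _ U U_fp.
pose V' : @full_subcat (Mod L^c) (@fin_presented L^c) :=
   @FullOb (Mod L^c) _ V V_fp.
have uK : tens u (1 : L^o) \in ker_pred (Tens_map i U).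
  by rewrite mem_torsion u0.
pose u1 : torsion_fp i U' := Ker uK.
have [x xE] : exists x : X, s U' u1 = tens u x.
  apply: pi_ker; apply: (etrans (esym (nt_natE s (pi : hom U' V') u1))).
  rewrite -[RHS](raddf0 (s V')); congr (s V' _); apply: val_inj.
  by apply: (etrans (tensor_mapE _ _ _ _)); rewrite piu0 tens0l.
pose s' : nattrans _ _ := modTens_map (mul_right x) ∘ torsion_incl.
have uE : s U' u1 = s' U' u1.
  rewrite xE; apply: esym; apply: (etrans (tensor_mapE _ _ _ _)).
  by rewrite /= /mul_right scale1r.
exists (mul_right x); apply: nt_ext => A z.
have [a za] := tens_regular (ker_val z).
have /u_univ[h ha] : tens a (i 1) = 0.
  by apply/eqP; rewrite -mem_torsion -za ker_valP.
have <- : fmap (torsion i) (h : @hom (Mod L^c) U (full_val A)) u1 = z.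
  by apply: val_inj; apply: etrans (esym za); rewrite -ha; apply: tensor_mapE.
apply: (etrans (nt_natE s (h : hom U' A) u1)).
apply: (etrans _ (esym (nt_natE s' (h : hom U' A) u1))).
by rewrite uE.
Qed.

(** Evaluation at the universal element gives [u ⊗ x 1 = 0], which [torsion_test] converts into a
    map out of [I]. *)
Lemma torsion_trans_eq0 (X : Mod L) (x : {linear L^o -> X}) :
  modTens_map x ∘ torsion_incl = hzero (torsion_fp i) (modTens X) ->
  exists k : {linear I -> X}, x = k \o i.
Proof.
have [U [_ [u [_ [[U_fp _] [u0 _] _ u_det _]]]]] :=
  torsion_test (i 1) I_fp.
pose U' : @full_subcat (Mod L^c) (@fin_presented L^c) :=
   @FullOb (Mod L^c) _ U U_fp.
have uK : tens u (1 : L^o) \in ker_pred (Tens_map i U).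
  by rewrite mem_torsion u0.
move=> /nt_eqE/(_ U' (Ker uK)) x0.
have [|k kE] := u_det X (x 1).
  by rewrite -[RHS]x0; apply: esym; apply: tensor_mapE.
exists k; apply: linear_ext => r /=.
by rewrite -[r in LHS]mulr1 -[r in RHS]mulr1 !linearZ /= kE.
Qed.

End TorsionTransformations.

Lemma kernel_mono (C : preadditive) (A B E : C) (f : hom A B) (g : hom B E)
    (X : C) (a b : hom X A) :
  is_kernel f g -> f ∘ a = f ∘ b -> a = b.
Proof.
move=> [gf fK] fab; have [|k [_ kU]] := fK X (f ∘ a).
  by rewrite compmA gf compm_zerol.
by rewrite -(kU a) // (kU b).
Qed.

(** * Exact contravariant functors turn presentations into kernels *)

Section ContravariantExactness.
Variable L : pzRingType.

Definition fpHom_map (M N : Mod L) (h : hom M N) : hom (fpHom N) (fpHom M) :=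
  Hom_map h.

Lemma yoneda_Hom (X : Mod L) (F : afunctor (Mod L) Ab) (s : nattrans (Hom X) F)
    (Y : Mod L) (f : {linear X -> Y}) :
  s Y f = fmap F (f : hom X Y) (s X idfun).
Proof. by rewrite -nt_natE; congr (s Y _); apply: linear_ext. Qed.

Variables (D : cofunctor (fpMod L) (modAb L)).
Hypothesis D_exact : exact_cofunctor D.

(** Exactness concerns short exact sequences inside [fpMod], so the presentation is cut at the image
    [K] of [s] into 0 -> Hom(Q, _) -> Hom(Y, _) -> K -> 0 and 0 -> K -> Hom(X, _) -> F -> 0. *)
Lemma exact_cofunctor_presentation (X Y : Mod L) (F : fpMod L)
    (s : hom (fpHom Y) (fpHom X)) (t : hom (fpHom X) F) :
  exact_at (s : nattrans _ _) t -> epi (t : nattrans _ _) ->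
  is_kernel (cmap D t) (cmap D s).
Proof.
move=> st t_epi.
(* By Yoneda [s] is precomposition with [h], so its kernel is represented by the cokernel [Q] of
   [h], and its image is the finitely presented functor Hom(Y, _) / Hom(Q, _). *)
pose h : {linear X -> Y} := (s : nattrans _ _) Y idfun.
have sE (Z : Mod L) (f : {linear Y -> Z}) : (s : nattrans _ _) Z f = f \o h.
  exact: yoneda_Hom.
pose Q : lmodType L := mod_coker h.
pose p : {linear Y -> Q} := mod_proj h.
pose K : fpMod L :=
  @FullOb (functor_cat (Mod L) Ab) _ _ (coker_Hom_fp (p : @hom (Mod L) Y Q)).
pose e : hom (fpHom Y) K := coker_proj (Hom_map (p : @hom (Mod L) Y Q)).
have e0 (Z : Mod L) (f : {linear Y -> Z}) :
    (e : nattrans _ _) Z f = 0 <-> 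
      exists g : {linear Q -> Z}, precomp p g = f.
  rewrite (qproj_eq0 _ (f : Hom Y Z)).
  split=> [/asboolP[g gf]|[g gf]]; first by exists g; exact: gf.
  by apply/asboolP; exists g.
have e0' (Z : Mod L) (f : {linear Y -> Z}) :
    (e : nattrans _ _) Z f = 0 <-> (s : nattrans _ _) Z f = 0.
  rewrite e0 sE; split=> [[g <-]|fh0].
    apply: linear_ext => x /=; rewrite (_ : p (h x) = 0) ?linear0 //.
    by apply/mod_proj_eq0; exists x.
  have [|g gE] := linear_factor (h := f) (mod_proj_surj (g := h)).
    move=> y /mod_proj_eq0[x <-].
    exact: (linear_eqE fh0 x).
  by exists g; apply: linear_ext.
have e_epi : epi (e : nattrans _ _) by move=> Z y; apply: qproj_surj.
have [Z f|j jE] := nt_factor (h := s : nattrans _ _) e_epi.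
  by rewrite e0'.
have p_short : short_exact (@fpHom_map Y Q p) e.
  apply: pointwise_short_exact => // Z f g fg; apply: linear_ext => z.
  by have [y <-] := mod_proj_surj z; apply: (linear_eqE fg y).
have j_short : short_exact (j : hom K (fpHom X)) t.
  apply: pointwise_short_exact => // [Z|Z f].
    apply: raddf_inj => y; have [f <-] := e_epi Z y.
    by rewrite jE -e0'.
  rewrite (st Z f); split=> -[y <-]; last by have [g <-] := e_epi Z y; exists g.
  by exists ((e : nattrans _ _) Z y).
have [Dtj _] := D_exact.2 _ _ _ _ _ j_short.
have [Dep _] := D_exact.2 _ _ _ _ _ p_short.
(* As [cmap D e] is itself a kernel, hence mono, [cmap D s] and [cmap D j] have the same kernel. *)
have -> : cmap D s = cmap D e ∘ cmap D (j : hom K (fpHom X)).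
  by rewrite -cmap_comp; congr (cmap D _); apply: nt_ext => Z f; rewrite -jE.
split=> [|W k]; first by rewrite -compmA Dtj.1 compm_zeror.
rewrite -compmA => k0; apply: Dtj.2; apply: (kernel_mono Dep).
by rewrite k0 compm_zeror.
Qed.

End ContravariantExactness.

(** * The bijection [f |-> cmap D f ∘ k] from Hom(F, q) to Hom(s, D F) *)

Section Representability.
Variables (L : pzRingType) (I : Mod L) (i : {linear L^o -> I}).
Hypothesis I_fp : fin_presented I.
Variable D : cofunctor (fpMod L) (modAb L).
Hypothesis D_exact : exact_cofunctor D.
Variable theta : forall M : Mod L, hom (D (fpHom M)) (modTens M).
Hypothesis theta_iso : forall M, is_iso (theta M).
Hypothesis theta_nat : forall (M N : Mod L) (h : hom M N),
  theta N ∘ cmap D (fpHom_map h) = modTens_map h ∘ theta M.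

Let R : Mod L := (L^o : lmodType L).
Let proj : hom (fpHom R) (cotorsion i) := coker_proj (Hom_map i).

Lemma cofunctor0 (F G : fpMod L) : cmap D (hzero F G) = hzero (D G) (D F).
Proof.
by apply: (@hadd_cancel _ _ _ (cmap D (hzero F G)));
  rewrite -D_exact.1 hadd0l hadd0r.
Qed.

Lemma theta_mono (M : Mod L) (W : modAb L) (a b : hom W (D (fpHom M))) :
  theta M ∘ a = theta M ∘ b -> a = b.
Proof.
have [g [gt _]] := theta_iso M => ab.
by rewrite -[a]compm_idl -[b]compm_idl -gt -!compmA ab.
Qed.

Lemma proj_exact : exact_at (Hom_map i) (proj : nattrans _ _).
Proof.
move=> Z f; rewrite (qproj_eq0 _ (f : Hom R Z)).
by split=> [/asboolP|fP] //; apply/asboolP.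
Qed.

Lemma proj_epi : epi (proj : nattrans _ _).
Proof. by move=> Z z; apply: qproj_surj. Qed.

(** The presentation of [q] makes [D q] the kernel of [_ ⊗ i], up to [theta]; the inclusion of
    torsion is killed by [_ ⊗ i] and so factors through it. *)
Lemma torsion_embedding :
  exists k : hom (torsion_fp i) (D (cotorsion i)),
    theta R ∘ (cmap D proj ∘ k) = torsion_incl i.
Proof.
have [_ projK] := exact_cofunctor_presentation D_exact proj_exact proj_epi.
have [g [_ tg]] := theta_iso R.
have [|k [kE _]] := projK _ (g ∘ torsion_incl i).
  apply: theta_mono.
  rewrite compmA (theta_nat (i : hom R I)) compmA -(compmA _ _ g) tg compm_idr.
  by rewrite modTens_map_torsion_incl compm_zeror.
by exists k; rewrite kE compmA tg compm_idl.
Qed.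

Variable k : hom (torsion_fp i) (D (cotorsion i)).
Hypothesis kE : theta R ∘ (cmap D proj ∘ k) = torsion_incl i.

(** Representables are projective: by Yoneda it suffices to lift the image of the identity of [X]
    along [proj]. *)
Lemma Hom_cotorsion (X : Mod L) (f : hom (fpHom X) (cotorsion i)) :
  exists x : hom R X, f = proj ∘ fpHom_map x.
Proof.
have [x xE] := proj_epi ((f : nattrans _ _) X idfun).
exists x; apply: nt_ext => Y g.
rewrite [LHS]yoneda_Hom -xE; apply: etrans (esym (nt_natE proj _ _)) _.
by congr ((proj : nattrans _ _) Y _); apply: linear_ext.
Qed.

Lemma theta_transpose (X : Mod L) (x : hom R X) :
  theta X ∘ (cmap D (proj ∘ fpHom_map x) ∘ k) =
  modTens_map x ∘ torsion_incl i.
Proof. by rewrite cmap_comp -!compmA compmA theta_nat -kE !compmA. Qed.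

(** If the transpose vanishes, the map [x] inducing [f] factors through [i], and [proj] kills
    precomposition with such a map. *)
Lemma transpose_Hom_inj (X : Mod L) (f : hom (fpHom X) (cotorsion i)) :
  cmap D f ∘ k = hzero (torsion_fp i) (D (fpHom X)) -> f = hzero _ _.
Proof.
have [x ->] := Hom_cotorsion f => x0.
have : modTens_map x ∘ torsion_incl i = hzero (torsion_fp i) (modTens X).
  by rewrite -theta_transpose x0 compm_zeror.
move=> /(torsion_trans_eq0 I_fp)[h xh].
apply: nt_ext => Y g; apply/proj_exact; exists (precomp h g).
by rewrite xh; apply: linear_ext.
Qed.

Lemma transpose_Hom_surj (X : Mod L) (s : hom (torsion_fp i) (D (fpHom X))) :
  exists f : hom (fpHom X) (cotorsion i), cmap D f ∘ k = s.
Proof.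
have [x xE] := torsion_trans_mul I_fp (theta X ∘ s).
exists (proj ∘ fpHom_map (x : hom R X)); apply: theta_mono.
by rewrite theta_transpose xE.
Qed.

Lemma transpose_inj (F : fpMod L) (f g : hom F (cotorsion i)) :
  cmap D f ∘ k = cmap D g ∘ k -> f = g.
Proof.
move=> fg; have [X [Y [s [t [_ t_epi]]]]] := full_valP F.
pose d : hom F (cotorsion i) := f ⊕ hopp g.
have d0 : cmap D d ∘ k = hzero _ _.
  apply: (@hadd_cancel _ _ _ (cmap D g ∘ k)); rewrite hadd0r -compm_addl.
  by rewrite -D_exact.1 /d haddC -haddA haddNl hadd0r.
(* The difference [d] of [f] and [g] is tested on the representable cover of [F]. *)
have dt0 : d ∘ (t : hom (fpHom X) F) = hzero _ _.
  by apply: transpose_Hom_inj; rewrite cmap_comp -compmA d0 compm_zeror.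
have {}d0 : d = hzero _ _.
  apply: nt_ext => A y; have [x <-] := t_epi A y.
  exact: (nt_eqE dt0 x).
by apply: (@hadd_cancel _ _ _ (hopp g)); rewrite haddNl haddC.
Qed.

Lemma transpose_surj (F : fpMod L) (s : hom (torsion_fp i) (D F)) :
  exists f : hom F (cotorsion i), cmap D f ∘ k = s.
Proof.
have [X [Y [u [t [ut t_epi]]]]] := full_valP F.
pose u' : hom (fpHom Y) (fpHom X) := u; pose t' : hom (fpHom X) F := t.
have DtK : is_kernel (cmap D t') (cmap D u').
  exact: exact_cofunctor_presentation.
(* The representable case lifts [s] over the cover [Hom X]. The lift kills [u'], because its
   transpose does and transposition is injective on [Hom Y], so it descends to [F]. *)
have [f fE] := transpose_Hom_surj (cmap D t' ∘ s).
have fu0 : f ∘ u' = hzero _ _.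
  apply: transpose_Hom_inj.
  by rewrite cmap_comp -compmA fE compmA DtK.1 compm_zerol.
have [|h hE] := nt_factor (h := f : nattrans _ _) t_epi.
  by move=> A x /ut[y <-]; apply: (nt_eqE fu0 y).
exists h; apply: (kernel_mono DtK).
by rewrite compmA -cmap_comp -fE; congr (cmap D _ ∘ _); apply: nt_ext.
Qed.

End Representability.

Theorem theorem5p17 (L : pzRingType) (I : lmodType L) (i : {linear L^o -> I})
    (D_A : cofunctor (fpMod L) (modAb L)) (D_R : cofunctor (modAb L) (fpMod L)) :
  left_FPE L -> injective_envelope i ->
  is_AGJ D_A -> right_adjoint D_A D_R ->
  isomorphic (D_R (torsion_fp i)) (cotorsion i).
Proof.
move=> [I' [i' [i'_env I'_fp]]] i_env [D_exact [theta [theta_iso theta_nat]]].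
move=> [phi [phi_bij _ phi_natl _]].
(* [left_FPE] provides some finitely presented envelope, which may differ from the given [i]. *)
have I_fp := injective_envelope_fin_presented i_env i'_env I'_fp.
have [k kE] := torsion_embedding i D_exact theta_iso theta_nat.
have k_inj := transpose_inj I_fp D_exact theta_nat kE.
have k_surj := transpose_surj I_fp D_exact theta_iso theta_nat kE.
(* Yoneda by hand: [a] from q to D_R s corresponds to [k] under the adjunction, and [f] from D_R s
   to q has the transpose that corresponds to the identity. Both composites have the same transpose
   as an identity. *)
have [a aE] : exists a, phi (cotorsion i) (torsion_fp i) a = k.
  by have [phiV _ phiVK] := phi_bij (cotorsion i) (torsion_fp i); exists (phiV k).
have [f fE] := k_surj _ (phi _ _ (idm (D_R (torsion_fp i)))).
exists f, a; split.
  by apply: (bij_inj (phi_bij _ _)); rewrite phi_natl aE.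
apply: k_inj.
by rewrite cmap_comp -compmA fE -phi_natl compm_idl aE cmap_id compm_idl.
Qed.
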